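(* Let $\Bbbk$ be an algebraically closed field, $G$ an abelian group with $\Bbbk$-character group $\hat G=\mathrm{Hom}(G,\Bbbk^\times)$, and $A$ a finite dimensional unital associative $G$-graded $\Bbbk$-algebra, with associated $\hat G$-action $\phi$. The injective algebra morphism $A\otimes\Bbbk\hat G\hookrightarrow A\otimes\Bbbk^G$, obtained by interpreting characters as functions $G\to\Bbbk$, restricts to an injective morphism of $G$-graded algebras $$\mathcal{Z}^\phi(A)\hookrightarrow\mathcal{Z}^G(A),$$ which intertwines the $G$-actions on $\mathcal{Z}^\phi(A)$ and $\mathcal{Z}^G(A)$. This is an isomorphism of $G\times\hat G$-graded algebras when $|G|$ is finite and not divisible by $\mathrm{char}(\Bbbk)$.
   Context: $G$ is written additively; $\partial a=g$ for $a\in A_g$. The $\hat G$-action on $A$ is $\phi:\hat G\to\mathrm{Aut}(A)$, $\phi_\chi(a)=\chi(\partial a)a$ for homogeneous $a$. $\mathcal{Z}^\phi(A)$ is the subalgebra of $A\otimes\Bbbk\hat G$ spanned by the $(x,\chi):=x\otimes\chi$ with $xy=\phi_\chi(y)x$ for all $y\in A$. It is $G\times\hat G$-graded: the component of degree $(g,\chi)$ consists of the elements $(x,\chi)\in\mathcal{Z}^\phi(A)$ with $x\in A_g$. It carries the $G$-action in which $g\in G$ sends $(x,\chi)$ to $(\chi(g)x,\chi)$. $\Bbbk^G$ is the algebra of all functions $G\to\Bbbk$; $A\otimes\Bbbk^G=\mathrm{Hom}_{\mathbf{Set}}(G,A)$ has pointwise multiplication, elements $\mathbf{x}:g\mapsto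 x^{(g)}$, and $G$-grading $(A\otimes\Bbbk^G)_g=A_g\otimes\Bbbk^G$. The $G$-centre is the $G$-graded subalgebra $$\mathcal{Z}^G(A)=\{\mathbf{x}\in A\otimes\Bbbk^G\mid x^{(g)}y=yx^{(g+h)}\text{ for all } g,h\in G,\ y\in A_h\},$$ with $G$-action in which $k\in G$ sends $\mathbf{x}$ to $\{g\mapsto x^{(k+g)}\}$. When $|G|$ is finite and not divisible by $\mathrm{char}(\Bbbk)$, $\mathcal{Z}^G(A)$ is also $\hat G$-graded by $\mathcal{Z}^G(A)_\chi=\{\mathbf{x}\in\mathcal{Z}^G(A)\mid x^{(g)}=\chi(g)x^{(0)}\ \forall g\in G\}$, so that it is $G\times\hat G$-graded. *)

(* Defs.v *)
From HB Require Import structures.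
From mathcomp Require Import all_boot all_order all_algebra finmap.
From mathcomp Require Import boolp classical_sets functions cardinality fsbigop.

Set Implicit Arguments.
Unset Strict Implicit.
Unset Printing Implicit Defensive.
Import GRing.Theory.
Local Open Scope classical_set_scope.
Local Open Scope ring_scope.

Section FiniteSupport.
Variables (I : choiceType) (V : nmodType).

Definition fin_supp (f : I -> V) : Prop := finite_set (f @^-1` [set~ 0]).

Lemma fin_suppP (f : I -> V) :
  fin_supp f <-> exists X : {fset I}, forall i, i \notin X -> f i = 0.
Proof.
split=> [fin|[X Xf]].
  exists (fset_set (f @^-1` [set~ 0])) => i; rewrite in_fset_set// => fi.
  by apply: contrapT => fi0; move/negP: fi; apply; rewrite inE.
apply: (@sub_finite_set _ _ [set` X]); last exact: finite_fset.
move=> i /= fi; apply: contrapT => /negP iX; apply: fi; exact: Xf.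
Qed.

Lemma fin_supp0 : fin_supp (fun=> 0).
Proof. by apply/fin_suppP; exists fset0. Qed.

Lemma fin_supp_delta i0 x : fin_supp (fun i => if i == i0 then x else 0).
Proof.
apply/fin_suppP; exists [fset i0]%fset => i; rewrite inE.
by case: eqP.
Qed.

End FiniteSupport.

Lemma fin_supp_comp (I : choiceType) (V W : nmodType) (f : I -> V)
    (h : I -> V -> W) :
  (forall i, h i 0 = 0) -> fin_supp f -> fin_supp (fun i => h i (f i)).
Proof.
move=> h0 /fin_suppP [X Xf]; apply/fin_suppP; exists X => i /Xf ->.
exact: h0.
Qed.

Lemma fin_supp_comp2 (I : choiceType) (V W U : nmodType) (f : I -> V)
    (f' : I -> W) (h : V -> W -> U) :
  h 0 0 = 0 -> fin_supp f -> fin_supp f' -> fin_supp (fun i => h (f i) (f' i)).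
Proof.
move=> h0 /fin_suppP [X Xf] /fin_suppP [Y Yf]; apply/fin_suppP.
exists (X `|` Y)%fset => i; rewrite inE negb_or => /andP[iX iY].
by rewrite Xf// Yf.
Qed.

Section Spans.
Variables (k : pzRingType) (V : lmodType k).

Definition is_subspace (W : set V) : Prop :=
  W 0 /\ forall (c : k) x y, W x -> W y -> W (c *: x + y).

Definition span (S : set V) : set V :=
  [set v | exists n (c : 'I_n -> k) (s : 'I_n -> V),
     (forall i, S (s i)) /\ v = \sum_(i < n) c i *: s i].

Lemma is_subspaceD W x y : is_subspace W -> W x -> W y -> W (x + y).
Proof. by case=> _ WS Wx Wy; rewrite -[x]scale1r; apply: WS. Qed.

Lemma is_subspaceZ W c x : is_subspace W -> W x -> W (c *: x).
Proof. by case=> W0 WS Wx; rewrite -[_ *: _]addr0; apply: WS. Qed.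

Lemma is_subspace_sum W n (F : 'I_n -> V) :
  is_subspace W -> (forall i, W (F i)) -> W (\sum_i F i).
Proof.
move=> sW WF; apply: big_ind => //; first by case: sW.
by move=> x y; apply: is_subspaceD.
Qed.

Lemma sub_span S : S `<=` span S.
Proof.
move=> v Sv; exists 1%N, (fun=> 1), (fun=> v); split=> //.
by rewrite big_ord1 scale1r.
Qed.

Lemma span_subspace S : is_subspace (span S).
Proof.
split.
  exists 0%N, (fun=> 0), (fun=> 0); split; first by case.
  by rewrite big_ord0.
move=> c _ _ [n [a [s [Ss ->]]]] [m [b [t [St ->]]]].
exists (n + m)%N,
  (fun i => match fintype.split i with inl j => c * a j | inr j => b j end),
  (fun i => match fintype.split i with inl j => s j | inr j => t j end).
split; first by move=> i; case: (fintype.split i).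
rewrite big_split_ord scaler_sumr; congr (_ + _); apply: eq_bigr => i _.
  by rewrite (unsplitK (inl i)) scalerA.
by rewrite (unsplitK (inr i)).
Qed.

Lemma span_least S W : is_subspace W -> S `<=` W -> span S `<=` W.
Proof.
move=> sW SW _ [n [c [s [Ss ->]]]]; apply: is_subspace_sum => // i.
by apply: is_subspaceZ => //; apply: SW; apply: Ss.
Qed.

End Spans.

Section Subalgebras.
Variables (k : fieldType) (B : algType k).

Definition is_subalgebra (S : set B) : Prop :=
  [/\ is_subspace S, S 1 & forall x y, S x -> S y -> S (x * y)].

Record subalgebra := Subalgebra {
  subalg_set :> set B;
  subalgP : is_subalgebra subalg_set
}.

Definition subalg_pred (S : subalgebra) : pred B := fun x => `[< subalg_set S x >].

Record subalg_of (S : subalgebra) := InSubalg {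
  subalg_val : B;
  _ : subalg_pred S subalg_val
}.

Section Instances.
Variable S : subalgebra.

HB.instance Definition _ := [isSub for @subalg_val S].
HB.instance Definition _ := [Choice of subalg_of S by <:].

Lemma subalg_pred_closed : GRing.subalg_closed (subalg_pred S).
Proof.
have [sS S1 SM] := subalgP S; split.
- exact/asboolP.
- move=> c u v; rewrite !unfold_in => /asboolP Su /asboolP Sv; apply/asboolP.
  by case: sS => _; apply.
- move=> u v; rewrite !unfold_in => /asboolP Su /asboolP Sv; apply/asboolP.
  exact: SM.
Qed.

HB.instance Definition _ :=
  GRing.SubChoice_isSubAlgebra.Build k B (subalg_pred S) (subalg_of S)
    subalg_pred_closed.

Lemma subalg_valP (x : subalg_of S) : subalg_set S (subalg_val x).
Proof. by case: x => x /= /asboolP. Qed.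

Definition subalg_in x (Sx : subalg_set S x) : subalg_of S :=
  InSubalg (introT (asboolP _) Sx).

End Instances.
End Subalgebras.

Section Gradings.
Variables (k : fieldType) (I : zmodType) (B : algType k).

(* The last clause says that B is the direct sum of the W i: every element is
   in a unique way the sum of a finitely supported family of elements of the
   W i. *)
Definition is_grading (W : I -> set B) : Prop :=
  [/\ forall i, is_subspace (W i),
      W 0 1,
      forall i j x y, W i x -> W j y -> W (i + j) (x * y)
    & forall x, exists! f : I -> B,
        [/\ fin_supp f, forall i, W i (f i) & x = \sum_(i \in [set: I]) f i]].

Record grading := Grading {
  hcomp :> I -> set B;
  gradingP : is_grading hcomp
}.

Variable W : grading.

Lemma grading_decP (x : B) : {f : I -> B |
  [/\ fin_supp f, forall i, W i (f i) & x = \sum_(i \in [set: I]) f i]}.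
Proof.
apply: cid; case: (gradingP W) => _ _ _ /(_ x) [f [fP _]]; by exists f.
Qed.

Definition hproj (i : I) (x : B) : B := sval (grading_decP x) i.

Lemma hproj_fin x : fin_supp (hproj^~ x).
Proof. by rewrite /hproj; case: (grading_decP x) => f []. Qed.

Lemma hproj_in i x : W i (hproj i x).
Proof. by rewrite /hproj; case: (grading_decP x) => f []. Qed.

Lemma hproj_sum x : x = \sum_(i \in [set: I]) hproj i x.
Proof. by case: (svalP (grading_decP x)). Qed.

Lemma hproj_uniq x (f : I -> B) :
  fin_supp f -> (forall i, W i (f i)) -> x = \sum_(i \in [set: I]) f i ->
  forall i, hproj i x = f i.
Proof.
move=> f1 f2 f3 i; case: (gradingP W) => _ _ _ /(_ x) [h [_ hu]].
have <- : h = f; first by apply: hu; split.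
have -> : h = hproj^~ x; last by [].
apply: hu; split; [exact: hproj_fin|move=> j; exact: hproj_in|exact: hproj_sum].
Qed.

Lemma hproj_homog i j x : W i x -> hproj j x = if j == i then x else 0.
Proof.
move=> Wx; apply: (@hproj_uniq x (fun j => if j == i then x else 0)).
- exact: fin_supp_delta.
- move=> l; case: eqP => [->//|_].
  by case: (gradingP W) => /(_ l) [].
- rewrite (fsbigTE [fset i]%fset).
    by rewrite big_seq_fset1 eqxx.
  by move=> l; rewrite inE => /negbTE ->.
Qed.

End Gradings.

(* The algebra of all functions T -> B with pointwise operations; for a group G
   and a finite dimensional A this is the tensor product of A and k^G. *)
Definition fun_alg (T : Type) (B : Type) : Type := T -> B.

Section FunAlgebra.
Variables (k : fieldType) (G : zmodType) (B : algType k).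

HB.instance Definition _ := GRing.PzRing.copy (fun_alg G B) (G -> B).
HB.instance Definition _ := GRing.Lmodule.copy (fun_alg G B) (G -> B).

Lemma fun_alg_oner_neq0 : 1 != 0 :> fun_alg G B.
Proof. by apply/eqP => /(congr1 (@^~ 0)) /eqP; rewrite oner_eq0. Qed.

HB.instance Definition _ :=
  GRing.PzSemiRing_isNonZero.Build (fun_alg G B) fun_alg_oner_neq0.

Lemma fun_alg_scalerAl (c : k) (x y : fun_alg G B) : c *: (x * y) = (c *: x) * y.
Proof. by apply/funext => t; exact: scalerAl. Qed.

Lemma fun_alg_scalerAr (c : k) (x y : fun_alg G B) : c *: (x * y) = x * (c *: y).
Proof. by apply/funext => t; exact: scalerAr. Qed.

HB.instance Definition _ :=
  GRing.Lmodule_isLalgebra.Build k (fun_alg G B) fun_alg_scalerAl.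
HB.instance Definition _ :=
  GRing.Lalgebra_isAlgebra.Build k (fun_alg G B) fun_alg_scalerAr.

End FunAlgebra.

(* The group algebra of an abelian group [Gam] (written additively) with
   coefficients in [B], i.e. the tensor product of B and k[Gam]: an element is
   its finitely supported family of coefficients; the product is convolution. *)
Section GroupAlgebra.
Variables (k : fieldType) (B : algType k) (Gam : zmodType).

Definition galg_pred : pred (Gam -> B) := fun f => `[< fin_supp f >].

Record galg := Galg { gcoef : Gam -> B; _ : galg_pred gcoef }.

HB.instance Definition _ := [isSub for gcoef].
HB.instance Definition _ := [Choice of galg by <:].

Lemma gcoef_fin (F : galg) : fin_supp (gcoef F).
Proof. by case: F => f /= /asboolP. Qed.

Definition galg_of (f : Gam -> B) (fin : fin_supp f) : galg :=
  Galg (introT (asboolP _) fin).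

Lemma galg_pred_closed : GRing.submod_closed galg_pred.
Proof.
split; first by apply/asboolP; exact: fin_supp0.
move=> c u v; rewrite !unfold_in => /asboolP fu /asboolP fv; apply/asboolP.
by apply: (fin_supp_comp2 (h := fun x y => c *: x + y)) => //; rewrite scaler0 addr0.
Qed.

HB.instance Definition _ :=
  GRing.SubChoice_isSubLmodule.Build k (Gam -> B) galg_pred galg
    galg_pred_closed.

Lemma galgP (F F' : galg) : (forall a, gcoef F a = gcoef F' a) -> F = F'.
Proof. by move=> FF'; apply: val_inj; apply/funext. Qed.

(* [gdelta x a] is the elementary tensor of x and a. *)
Definition gdelta (x : B) (a : Gam) : galg :=
  galg_of (fin_supp_delta a x).

Definition gconv (f f' : Gam -> B) (c : Gam) : B :=
  \sum_(a \in [set: Gam]) f a * f' (c - a).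

Lemma gconvE (X : {fset Gam}) f f' c : (forall a, a \notin X -> f a = 0) ->
  gconv f f' c = \sum_(a <- X) f a * f' (c - a).
Proof. by move=> Xf; apply: fsbigTE => a /Xf ->; rewrite mul0r. Qed.

Lemma gconv_supp (X Y : {fset Gam}) f f' :
  (forall a, a \notin X -> f a = 0) -> (forall a, a \notin Y -> f' a = 0) ->
  forall c, c \notin [fset (a + b)%R | a in X, b in Y]%fset -> gconv f f' c = 0.
Proof.
move=> Xf Yf' c cXY; rewrite (gconvE _ _ Xf) big_seq big1// => a aX.
rewrite [f' _]Yf' ?mulr0//; apply: contra cXY => caY.
by apply/imfset2P; exists a => //; exists (c - a) => //; rewrite addrC subrK.
Qed.

Lemma gconv_fin f f' : fin_supp f -> fin_supp f' -> fin_supp (gconv f f').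
Proof.
move=> /fin_suppP [X Xf] /fin_suppP [Y Yf']; apply/fin_suppP.
eexists; exact: gconv_supp Xf Yf'.
Qed.

Definition galg_mul (F F' : galg) : galg :=
  galg_of (gconv_fin (gcoef_fin F) (gcoef_fin F')).

Definition galg_one : galg := gdelta 1 0.

Lemma galg_mulA : associative galg_mul.
Proof.
move=> F F' F''; apply: galgP => c /=.
have /fin_suppP[X Xf] := gcoef_fin F.
have /fin_suppP[Y Yf] := gcoef_fin F'.
rewrite (gconvE _ _ Xf) (gconvE _ _ (gconv_supp Xf Yf)).
set Z := [fset _ | _ in _, _ in _]%fset.
under [RHS]eq_bigr => b _ do rewrite (gconvE _ _ Xf) mulr_suml.
rewrite exchange_big /= big_seq [RHS]big_seq; apply: eq_bigr => a aX.
rewrite (gconvE _ _ Yf) mulr_sumr.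
transitivity (\sum_(b \in [set: Gam])
    gcoef F a * gcoef F' (b - a) * gcoef F'' (c - b)); last first.
  apply: fsbigTE => b bZ; rewrite [gcoef F' _]Yf ?mulr0 ?mul0r//.
  apply: contra bZ => baY.
  by apply/imfset2P; exists a => //; exists (b - a) => //; rewrite addrC subrK.
rewrite (reindex_fsbigT (fun d => d + a)); last first.
  by exists (fun b => b - a) => b; rewrite ?addrK ?subrK.
rewrite (fsbigTE Y); last first.
  by move=> d /Yf Yd; rewrite addrK Yd mulr0 mul0r.
apply: eq_bigr => d _; rewrite addrK mulrA; congr (_ * gcoef F'' _).
by rewrite opprD addrAC addrA.
Qed.

Lemma galg_mul1 : left_id galg_one galg_mul.
Proof.
move=> F; apply: galgP => c /=.
rewrite (gconvE (X := [fset 0]%fset)) ?big_seq_fset1 ?eqxx ?subr0 ?mul1r//.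
by move=> a; rewrite inE => /negbTE ->.
Qed.

Lemma galg_mulr1 : right_id galg_one galg_mul.
Proof.
move=> F; apply: galgP => c /=.
rewrite /gconv (fsbigTE [fset c]%fset) ?big_seq_fset1 ?subrr ?eqxx ?mulr1//.
by move=> a; rewrite inE subr_eq0 eq_sym => /negbTE ->; rewrite mulr0.
Qed.

Lemma galg_mulDl : left_distributive galg_mul +%R.
Proof.
move=> F F' F''; apply: galgP => c.
rewrite [RHS]/= -[RHS]/(gconv _ _ c + gconv _ _ c).
have /fin_suppP[X Xf] := gcoef_fin F.
have /fin_suppP[Y Yf] := gcoef_fin F'.
have XY a : a \notin (X `|` Y)%fset -> gcoef F a = 0 /\ gcoef F' a = 0.
  by rewrite inE negb_or => /andP[/Xf -> /Yf ->].
rewrite [LHS]/= !(gconvE (X := (X `|` Y)%fset)); last 3 first.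
- by move=> a /XY [].
- by move=> a /XY [].
- by move=> a /XY [Fa F'a]; rewrite -[LHS]/(gcoef F a + gcoef F' a) Fa F'a addr0.
by rewrite -big_split; apply: eq_bigr => a _; exact: mulrDl.
Qed.

Lemma galg_mulDr : right_distributive galg_mul +%R.
Proof.
move=> F F' F''; apply: galgP => c.
rewrite [RHS]/= -[RHS]/(gconv _ _ c + gconv _ _ c).
have /fin_suppP[X Xf] := gcoef_fin F.
rewrite [LHS]/= !(gconvE _ _ Xf) -big_split; apply: eq_bigr => a _.
exact: mulrDr.
Qed.

Lemma galg_one_neq0 : galg_one != 0.
Proof.
apply/eqP => /(congr1 (fun F => gcoef F 0)) /=; rewrite eqxx => /eqP.
by rewrite oner_eq0.
Qed.

HB.instance Definition _ := GRing.Zmodule_isNzRing.Build galg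
  galg_mulA galg_mul1 galg_mulr1 galg_mulDl galg_mulDr galg_one_neq0.

Lemma galg_scalerAl (c : k) (F F' : galg) : c *: (F * F') = (c *: F) * F'.
Proof.
apply: galgP => a; have /fin_suppP[X Xf] := gcoef_fin F.
rewrite -[LHS]/(c *: gconv _ _ a) [RHS]/= (gconvE _ _ Xf) (gconvE (X := X)).
  by rewrite scaler_sumr; apply: eq_bigr => b _; exact: scalerAl.
by move=> b /Xf Fb; rewrite -[LHS]/(c *: gcoef F b) Fb scaler0.
Qed.

Lemma galg_scalerAr (c : k) (F F' : galg) : c *: (F * F') = F * (c *: F').
Proof.
apply: galgP => a; have /fin_suppP[X Xf] := gcoef_fin F.
rewrite -[LHS]/(c *: gconv _ _ a) [RHS]/= !(gconvE _ _ Xf).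
by rewrite scaler_sumr; apply: eq_bigr => b _; exact: scalerAr.
Qed.

HB.instance Definition _ := GRing.Lmodule_isLalgebra.Build k galg galg_scalerAl.
HB.instance Definition _ := GRing.Lalgebra_isAlgebra.Build k galg galg_scalerAr.

Lemma gdeltaM x y a b : gdelta x a * gdelta y b = gdelta (x * y) (a + b).
Proof.
apply: galgP => c /=.
rewrite (gconvE (X := [fset a]%fset)) ?big_seq_fset1 ?eqxx.
  by rewrite subr_eq addrC eq_sym; case: eqP => // _; rewrite mulr0.
by move=> d; rewrite inE => /negbTE ->.
Qed.

End GroupAlgebra.

(* The characters of G with values in the units of k.  Their group law, the
   pointwise product, is registered as a [zmodType], hence written additively. *)
Section Characters.
Variables (k : fieldType) (G : zmodType).

Definition is_character (chi : G -> k) : Prop :=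
  (forall g, chi g \is a GRing.unit) /\
  (forall g h, chi (g + h) = chi g * chi h).

Definition char_pred : pred (G -> k) := fun chi => `[< is_character chi >].

Record chargrp := CharGrp { char_fun :> G -> k; _ : char_pred char_fun }.

HB.instance Definition _ := [isSub for char_fun].
HB.instance Definition _ := [Choice of chargrp by <:].

Definition char_of (chi : G -> k) (P : is_character chi) : chargrp :=
  CharGrp (introT (asboolP _) P).

Lemma chargrpP (chi : chargrp) : is_character chi.
Proof. by case: chi => f /= /asboolP. Qed.

Lemma char_eq (chi psi : chargrp) : (forall g, chi g = psi g) -> chi = psi.
Proof. by move=> cp; apply: val_inj; apply/funext. Qed.

Lemma char_unit (chi : chargrp) g : chi g \is a GRing.unit.
Proof. by case: (chargrpP chi). Qed.

Lemma charD (chi : chargrp) g h : chi (g + h) = chi g * chi h.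
Proof. by case: (chargrpP chi). Qed.

Lemma char_one_subproof : is_character (fun=> 1).
Proof. by split=> *; rewrite ?unitr1 ?mulr1. Qed.

Lemma char_mul_subproof (chi psi : chargrp) :
  is_character (fun g => chi g * psi g).
Proof.
split=> [g|g h]; first by rewrite unitrM !char_unit.
by rewrite !charD mulrACA.
Qed.

Lemma char_inv_subproof (chi : chargrp) : is_character (fun g => (chi g)^-1).
Proof.
split=> [g|g h]; first by rewrite unitrV char_unit.
by rewrite charD invrM ?char_unit// mulrC.
Qed.

Definition char_one := char_of char_one_subproof.
Definition char_mul chi psi := char_of (char_mul_subproof chi psi).
Definition char_inv chi := char_of (char_inv_subproof chi).

Lemma char_mulA : associative char_mul.
Proof. by move=> x y z; apply: char_eq => g /=; rewrite mulrA. Qed.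
Lemma char_mulC : commutative char_mul.
Proof. by move=> x y; apply: char_eq => g /=; rewrite mulrC. Qed.
Lemma char_mul1 : left_id char_one char_mul.
Proof. by move=> x; apply: char_eq => g /=; rewrite mul1r. Qed.
Lemma char_mulV : left_inverse char_one char_inv char_mul.
Proof. by move=> x; apply: char_eq => g /=; rewrite mulVr ?char_unit. Qed.

HB.instance Definition _ :=
  GRing.isZmodule.Build chargrp char_mulA char_mulC char_mul1 char_mulV.

End Characters.

Section Centres.
Variables (k : fieldType) (G : zmodType) (A : algType k) (W : grading G A).
Local Notation hatG := (chargrp k G).

(* The action of chi: the linear map sending a homogeneous element a of degree
   g to [chi g *: a]. *)
Definition phi (chi : hatG) (a : A) : A :=
  \sum_(g \in [set: G]) chi g *: hproj W g a.

Lemma phi_homog (chi : hatG) g a : W g a -> phi chi a = chi g *: a.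
Proof.
move=> Wa; rewrite /phi (fsbigTE [fset g]%fset).
  by rewrite big_seq_fset1 (hproj_homog _ Wa) eqxx.
by move=> h; rewrite inE => /negbTE hg; rewrite (hproj_homog _ Wa) hg scaler0.
Qed.

Lemma phi_hproj (chi : hatG) g a : hproj W g (phi chi a) = chi g *: hproj W g a.
Proof.
apply: (hproj_uniq (f := fun g => chi g *: hproj W g a)) => //.
- apply: (fin_supp_comp (h := fun g x => chi g *: x)); last exact: hproj_fin.
  by move=> h; rewrite scaler0.
- move=> h; apply: is_subspaceZ; last exact: hproj_in.
  by case: (gradingP W).
Qed.

Lemma phiD (chi psi : hatG) a : phi chi (phi psi a) = phi (chi + psi) a.
Proof.
by apply: eq_fsbigr => g _; rewrite phi_hproj scalerA.
Qed.

Lemma phi0 a : phi 0 a = a.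
Proof.
by rewrite [RHS](hproj_sum W); apply: eq_fsbigr => g _; exact: scale1r.
Qed.

Definition phi_central (x : A) (chi : hatG) : Prop :=
  forall y, x * y = phi chi y * x.

Definition phi_centre_set : set (galg A hatG) :=
  span [set F | exists x chi, phi_central x chi /\ F = gdelta x chi].

Lemma phi_centre_subalg : is_subalgebra phi_centre_set.
Proof.
split; first exact: span_subspace.
  apply: sub_span; exists 1, 0; split=> // y.
  by rewrite phi0 mul1r mulr1.
move=> _ _ [n [c [s [Ss ->]]]] [m [d [t [St ->]]]].
rewrite mulr_suml; apply: is_subspace_sum; first exact: span_subspace.
move=> i; rewrite mulr_sumr; apply: is_subspace_sum; first exact: span_subspace.
move=> j; rewrite -scalerAl -scalerAr.
do 2!(apply: is_subspaceZ; first exact: span_subspace).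
have [x [chi [xP ->]]] := Ss i; have [y [psi [yP ->]]] := St j.
apply: sub_span; exists (x * y), (chi + psi); split; last exact: gdeltaM.
by move=> z; rewrite -mulrA yP mulrA xP phiD -mulrA.
Qed.

Definition phi_centre : subalgebra (galg A hatG) :=
  Subalgebra phi_centre_subalg.

Definition G_centre_set : set (fun_alg G A) :=
  [set x | forall g h (y : A), W h y -> x g * y = y * x (g + h)].

Lemma G_centre_subalg : is_subalgebra G_centre_set.
Proof.
split; first split.
- by move=> g h y _ /=; rewrite mul0r mulr0.
- move=> c u v Zu Zv g h y Wy.
  rewrite -[LHS]/((c *: u g + v g) * y).
  rewrite -[RHS]/(y * (c *: u (g + h) + v (g + h))).
  by rewrite mulrDl mulrDr -scalerAl -scalerAr (Zu _ _ _ Wy) (Zv _ _ _ Wy).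
- by move=> g h y _; rewrite -[LHS]/(1 * y) -[RHS]/(y * 1) mul1r mulr1.
- move=> u v Zu Zv g h y Wy.
  rewrite -[LHS]/(u g * v g * y) -[RHS]/(y * (u (g + h) * v (g + h))).
  by rewrite -mulrA (Zv _ _ _ Wy) !mulrA (Zu _ _ _ Wy).
Qed.

Definition G_centre : subalgebra (fun_alg G A) := Subalgebra G_centre_subalg.

End Centres.

Section CentreStructure.
Variables (k : fieldType) (G : zmodType) (A : algType k) (W : grading G A).
Local Notation hatG := (chargrp k G).
Local Notation Zphi := (subalg_of (phi_centre W)).
Local Notation ZG := (subalg_of (G_centre W)).

Definition phi_centre_bicomp (i : G * hatG) : set Zphi :=
  [set z : Zphi | exists2 x, W i.1 x & subalg_val z = gdelta x i.2].

(* The grading by G obtained from [phi_centre_bicomp] by forgetting the degree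
   in hatG: the sum over chi of the components of degree (g, chi). *)
Definition phi_centre_comp (g : G) : set Zphi :=
  span [set z : Zphi | exists chi, phi_centre_bicomp (g, chi) z].

Lemma galg_twist_fin (g : G) (F : galg A hatG) :
  fin_supp (fun chi : hatG => chi g *: gcoef F chi).
Proof.
apply: (@fin_supp_comp hatG A A (gcoef F) (fun chi x => chi g *: x)).
  by move=> chi; rewrite scaler0.
exact: gcoef_fin.
Qed.

(* The linear extension of [gdelta x chi |-> gdelta (chi g *: x) chi]. *)
Definition galg_twist (g : G) (F : galg A hatG) : galg A hatG :=
  galg_of (galg_twist_fin g F).

Lemma galg_twist_lin g (c : k) F F' :
  galg_twist g (c *: F + F') = c *: galg_twist g F + galg_twist g F'.
Proof.
apply: galgP => chi.
rewrite -[LHS]/(chi g *: (c *: gcoef F chi + gcoef F' chi)).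
rewrite -[RHS]/(c *: (chi g *: gcoef F chi) + chi g *: gcoef F' chi).
by rewrite scalerDr !scalerA [c * _]mulrC.
Qed.

Lemma galg_twist_delta g x (chi : hatG) :
  galg_twist g (gdelta x chi) = gdelta (chi g *: x) chi.
Proof. by apply: galgP => psi /=; case: eqP => [->//|_]; rewrite scaler0. Qed.

Lemma galg_twist_centre g F :
  phi_centre_set W F -> phi_centre_set W (galg_twist g F).
Proof.
have [sZ _ _] := phi_centre_subalg W.
apply: (span_least (W := [set F | phi_centre_set W (galg_twist g F)])).
  split=> [|c u v Zu Zv] /=.
    rewrite (_ : galg_twist g 0 = 0); first by case: sZ.
    by apply: galgP => chi /=; rewrite scaler0.
  by rewrite galg_twist_lin; case: sZ => _; apply.
move=> _ [x [chi [xP ->]]] /=; rewrite galg_twist_delta.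
apply: sub_span; exists (chi g *: x), chi; split=> // y.
by rewrite -scalerAl xP scalerAr.
Qed.

Definition phi_centre_act (g : G) (z : Zphi) : Zphi :=
  subalg_in (S := phi_centre W) (galg_twist_centre g (subalg_valP z)).

Definition G_centre_comp (g : G) : set ZG :=
  [set z : ZG | forall h, W g (subalg_val z h)].

Definition G_centre_char_comp (chi : hatG) : set ZG :=
  [set z : ZG | forall g, subalg_val z g = chi g *: subalg_val z 0].

Definition G_centre_bicomp (i : G * hatG) : set ZG :=
  G_centre_comp i.1 `&` G_centre_char_comp i.2.

Lemma G_centre_shift (l : G) (x : fun_alg G A) :
  G_centre_set W x -> G_centre_set W (fun g => x (l + g)).
Proof. by move=> Zx g h y Wy; rewrite (Zx _ _ _ Wy) addrA. Qed.

Definition G_centre_act (l : G) (z : ZG) : ZG :=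
  subalg_in (S := G_centre W) (G_centre_shift l (subalg_valP z)).

End CentreStructure.

Section GradedMorphisms.
Variables (k : fieldType) (I : zmodType) (B B' : algType k).

Definition is_graded_morphism (W : I -> set B) (W' : I -> set B')
    (f : {lrmorphism B -> B'}) : Prop :=
  [/\ is_grading W, is_grading W' & forall i x, W i x -> W' i (f x)].

End GradedMorphisms.

Definition is_graded_isomorphism (k : fieldType) (I : zmodType)
    (B B' : algType k) (W : I -> set B) (W' : I -> set B')
    (f : {lrmorphism B -> B'}) : Prop :=
  is_graded_morphism W W' f /\
  exists f' : {lrmorphism B' -> B},
    [/\ is_graded_morphism W' W f', cancel f f' & cancel f' f].

(* Main.v *)
Require Import Defs.
From HB Require Import structures.
From mathcomp Require Import all_boot all_order all_algebra all_field finmap.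
From mathcomp Require Import cyclic.
From mathcomp Require Import boolp classical_sets functions cardinality fsbigop.
Set Implicit Arguments.
Unset Strict Implicit.
Unset Printing Implicit Defensive.
Import GRing.Theory.
Local Open Scope classical_set_scope.
Local Open Scope ring_scope.

(* A phi-central element x for the character chi gives the function
   g |-> chi g *: x of the G-centre, and linear independence of characters makes
   this evaluation injective.  Homogeneous components of central elements are
   central, which yields the gradings.  If G has order n invertible in k, the
   translations of functions on G are commuting operators of order n on the
   G-centre; since k contains a primitive n-th root of unity they are
   simultaneously diagonalisable.  A nonzero joint eigenvector u has
   u g = chi g *: u 0 for a character chi and is the image of (u 0, chi), so
   evaluation is surjective and the G x hatG-grading is transported along it. *)

(** * Joint eigenvectors of commuting operators of finite order *)

Section SimultaneousDiagonalisation.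
Variables (k : closedFieldType) (V : lmodType k).

(** ['X^n - 1] splits over [k] and is separable because [n] is invertible; its [n] distinct roots
    then include a primitive one. *)
Lemma closed_field_prim_root (n : nat) : n%:R != 0 :> k ->
  exists w : k, n.-primitive_root w.
Proof.
move=> n0; have n_gt0 : (0 < n)%N by case: n n0; rewrite ?eqxx.
have [r] := closed_field_poly_normal ('X^n - 1 : {poly k}).
have /monicP -> := monicXnsubC (1 : k) n_gt0; rewrite scale1r => rE.
have r_uniq : uniq r by rewrite -separable_prod_XsubC -rE separable_Xn_sub_1.
have r_size : size r = n.
  by apply: succn_inj; rewrite -(size_prod_XsubC r id) -rE size_XnsubC.
have r_root : all n.-unity_root r.
  by apply/allP => z zr; rewrite /root_of_unity rE root_prod_XsubC.
have /hasP[w _ wP] := has_prim_root n_gt0 r_root r_uniq (eq_leq (esym r_size)).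
by exists w.
Qed.

(** The components are linear combinations of the iterates of [T] on [v], whence the last clause.
    Applied to eigenspaces of operators commuting with [T], it allows several operators to be
    diagonalised one after another. *)
Lemma eigen_decomposition (T : {linear V -> V}) (n : nat) (v : V) :
  n%:R != 0 :> k -> iter n T v = v ->
  exists u : 'I_n -> V,
    [/\ v = \sum_i u i,
        forall i, exists c : k, T (u i) = c *: u i
      & forall P : set V, is_subspace P -> (forall x, P x -> P (T x)) -> P v ->
          forall i, P (u i)].
Proof.
move=> n0 Tn; have [w wP] := closed_field_prim_root n0.
have w0 : w != 0.
  apply/eqP => w0; have := prim_expr_order wP.
  rewrite w0 expr0n -[n == _]negbK -lt0n (prim_order_gt0 wP) /= => /eqP.
  by rewrite eq_sym oner_eq0.
(* The discrete Fourier transform of the T-orbit of v; the i-th component has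
   eigenvalue w ^- i. *)
exists (fun i => n%:R^-1 *: \sum_(0 <= j < n) (w ^+ i) ^+ j *: iter j T v).
split.
- rewrite -scaler_sumr exchange_big /=.
  (* Orthogonality of roots of unity: for [0 < j < n] the geometric sum is annihilated by the
     nonzero factor [w ^+ j - 1]. *)
  have powsum j : (j < n)%N ->
      \sum_(i < n) (w ^+ i) ^+ j = if j == 0%N then n%:R else 0.
    move=> jn; case: eqP => [->|/eqP j0].
      under eq_bigr => i _ do rewrite expr0.
      by rewrite sumr_const card_ord.
    have wj : w ^+ j - 1 != 0.
      by rewrite subr_eq0 -(prim_order_dvd wP) gtnNdvd // lt0n.
    apply: (mulfI wj); rewrite mulr0; under eq_bigr => i _ do rewrite exprAC.
    by rewrite -subrX1 exprAC (prim_expr_order wP) expr1n subrr.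
  under eq_big_nat => j /andP[_ jn].
    rewrite -scaler_suml (powsum j jn).
    over.
  have n_gt0 := prim_order_gt0 wP.
  rewrite big_ltn //= [X in _ + X]big_nat_cond [X in _ + X]big1 ?addr0.
    by rewrite scalerA mulVf // scale1r.
  by move=> [|j] //= _; rewrite scale0r.
- move=> i; pose F j := (w ^+ i) ^+ j *: iter j T v.
  (* [T] followed by the scalar [w ^+ i] sends each summand to the next one, and the summands have
     period [n], so their sum is fixed by this composite. *)
  have TF j : w ^+ i *: T (F j) = F j.+1 by rewrite /F linearZ scalerA -exprS.
  have Fn : F n = F 0%N.
    by rewrite /F Tn exprAC (prim_expr_order wP) expr1n expr0.
  have Fcycle : \sum_(0 <= j < n) F j.+1 = \sum_(0 <= j < n) F j.
    apply: (addrI (F 0%N)).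
    by rewrite -big_nat_recl // big_nat_recr //= Fn addrC.
  exists (w ^+ i)^-1; rewrite -/(F _) linearZ scalerA mulrC -scalerA.
  congr (_ *: _); apply: (scalerI (expf_neq0 i w0)).
  rewrite scalerA mulfV ?expf_neq0 // scale1r linear_sum scaler_sumr -/(F _).
  by under eq_bigr => j _ do rewrite -/(F j) TF.
- move=> P sP PT Pv i; apply: is_subspaceZ => //.
  apply: (big_ind P) => [|x y|j _]; first by case: sP.
  + exact: is_subspaceD.
  + by apply: is_subspaceZ => //; elim: j => //= j; exact: PT.
Qed.

(** Induction on [s]: a joint eigenvector for [s] is split along one more operator [T g]. The
    eigenspaces of the earlier operators are stable under [T g] by commutation, so they contain the
    pieces. *)
Lemma span_joint_eigen (I : eqType) (T : I -> {linear V -> V}) (n : nat) :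
  n%:R != 0 :> k -> (forall i v, iter n (T i) v = v) ->
  (forall i j v, T i (T j v) = T j (T i v)) ->
  forall (s : seq I) v,
    Defs.span [set u | forall i, i \in s -> exists c : k, T i u = c *: u] v.
Proof.
move=> n0 Tn Tcomm; elim=> [|g s IHs] v; first by apply: Defs.sub_span => i.
apply: (span_least (span_subspace _)) (IHs v) => u Eu.
have [e [uE eE eP]] := eigen_decomposition n0 (Tn g u); rewrite uE.
apply: is_subspace_sum => [|i]; first exact: span_subspace.
apply: Defs.sub_span => h; rewrite in_cons => /predU1P[->//|hs].
have [c uc] := Eu _ hs; exists c.
apply: (eP [set x | T h x = c *: x]) => //=.
- split=> [|a x y /= xE yE] /=; first by rewrite linear0 scaler0.
  by rewrite linearP xE yE scalerDr !scalerA mulrC.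
- by move=> x xE; rewrite Tcomm xE linearZ.
Qed.

End SimultaneousDiagonalisation.

(* Translation by [g] permutes [X], so it does not change the sum of [X]. *)
Lemma fset_zmod_mulrn (G : zmodType) (X : {fset G}) (g : G) :
  (forall x, x \in X) -> g *+ #|` X| = 0.
Proof.
move=> XT; have XF (F : G -> G) : \sum_(x <- X) F x = \sum_(x \in [set: G]) F x.
  by rewrite (fsbigTE X) // => x; rewrite XT.
have : \sum_(x <- X) (x + g) = \sum_(x <- X) x.
  rewrite !XF [RHS](reindex_fsbigT (fun x => x + g)) //.
  by exists (fun x => x - g) => x; rewrite ?addrK ?subrK.
rewrite big_split /= => /eqP; rewrite -[eqbRHS]addr0 => /eqP/addrI.
by rewrite big_const_seq count_predT -Monoid.iteropE.
Qed.

Lemma is_subspace_bigsum (k : pzRingType) (V : lmodType k) (P : set V)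
    (J : Type) (r : seq J) (F : J -> V) :
  is_subspace P -> (forall j, P (F j)) -> P (\sum_(j <- r) F j).
Proof.
move=> sP PF; apply: big_ind => //; first by case: sP.
by move=> x y; exact: is_subspaceD.
Qed.

(** * Gradings recognised by projections, and their transport *)

Section GradingsByProjections.
Variables (k : fieldType) (I : zmodType).

(** The spanning hypothesis makes the family of projections of [x] finitely supported with sum [x].
    Applying [p i] to any decomposition isolates its term of degree [i], which gives uniqueness. *)
Lemma is_grading_proj (B : algType k) (W : I -> set B) (p : I -> B -> B) :
  (forall i, is_subspace (W i)) -> W 0 1 ->
  (forall i j x y, W i x -> W j y -> W (i + j) (x * y)) ->
  (forall i, {morph p i : x y / x + y}) ->
  (forall i x, W i (p i x)) ->
  (forall i j x, W i x -> p j x = if j == i then x else 0) ->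
  (forall x, Defs.span [set x | exists i, W i x] x) ->
  is_grading W.
Proof.
move=> sW W1 WM pD pW pE Wspan; split=> // x.
have p0 i : p i 0 = 0 by apply: (addrI (p i 0)); rewrite -pD !addr0.
exists (p^~ x); split.
  have [n [c [s [/choice[d ds] xE]]]] := Wspan x.
  (* Of a spanning sum, [p i] keeps the terms whose degree [d j] is [i], so the support lies in the
     finite set of these degrees. *)
  have pE' i : p i x = \sum_(j < n) if i == d j then c j *: s j else 0.
    rewrite xE (big_morph (p i) (pD i) (p0 i)); apply: eq_bigr => j _.
    by apply: pE; apply: is_subspaceZ.
  pose X := [fset d j | j : 'I_n]%fset.
  have dX j : d j \in X by apply/imfsetP; exists j.
  have Xp i : i \notin X -> p i x = 0.
    move=> iX; rewrite pE' big1 // => j _; case: eqP iX => // ->.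
    by rewrite dX.
  split=> //; first by apply/fin_suppP; exists X.
  rewrite (fsbigTE X) //; under eq_bigr => i _ do rewrite pE'.
  rewrite exchange_big xE; apply: eq_bigr => j _ /=.
  rewrite (bigD1_seq (d j)) ?fset_uniq //= eqxx big1 ?addr0 // => i.
  by move=> /negbTE ->.
move=> f [/fin_suppP[X Xf] Wf ->]; apply/funext => i.
rewrite (fsbigTE X) // (big_morph (p i) (pD i) (p0 i)).
under eq_bigr => j _ do rewrite (pE _ _ _ (Wf j)).
rewrite -big_mkcond big_fset_condE /=.
have [iX|iX] := boolP (i \in X); last first.
  rewrite Xf // big_seq_cond big1 // => j.
  rewrite !inE => /andP[/andP[jX /eqP ij]].
  by rewrite ij jX in iX.
rewrite (_ : [fset j | j in X & i == j]%fset = [fset i]%fset).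
  by rewrite big_seq_fset1.
apply/fsetP => j; rewrite !inE /= (eq_sym i).
by case: eqVneq => [->|_]; rewrite ?iX ?andbF.
Qed.

(** Combining the decompositions of [x] and [y] termwise decomposes the combination, and
    decompositions are unique. *)
Lemma hproj_linear (B : algType k) (W : grading I B) i : linear (hproj W i).
Proof.
move=> c x y; have [sW _ _ _] := gradingP W.
have /fin_suppP[X Xx] := hproj_fin W x.
have /fin_suppP[Y Yy] := hproj_fin W y.
apply: (hproj_uniq (f := fun i => c *: hproj W i x + hproj W i y)).
- apply: (fin_supp_comp2 (h := fun x y => c *: x + y)); try exact: hproj_fin.
  by rewrite scaler0 addr0.
- by move=> j; case: (sW j) => _; apply; exact: hproj_in.
- have XY j : j \notin (X `|` Y)%fset -> hproj W j x = 0 /\ hproj W j y = 0.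
    by rewrite inE negb_or => /andP[/Xx -> /Yy ->].
  rewrite (fsbigTE (X `|` Y)%fset) => [|j /XY[-> ->]]; last first.
    by rewrite scaler0 addr0.
  rewrite big_split -scaler_sumr {1}(hproj_sum W x) {1}(hproj_sum W y).
  by rewrite !(fsbigTE (X `|` Y)%fset) // => j /XY[].
Qed.

HB.instance Definition _ (B : algType k) (W : grading I B) i :=
  GRing.isLinear.Build k B B *:%R (hproj W i) (hproj_linear W i).

(** That [W'] is a grading is part of the conclusion: it is transported along [f]. The bigrading of
    the [G]-centre arises in this way. *)
Lemma bij_graded_isomorphism (B B' : algType k) (W : I -> set B)
    (W' : I -> set B') (f : {lrmorphism B -> B'}) :
  is_grading W -> (forall i x, W' i (f x) <-> W i x) ->
  injective f -> (forall y, exists x, f x = y) -> is_graded_isomorphism W W' f.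
Proof.
move=> gW WW' injf surjf.
pose g y := sval (cid (surjf y)).
have gK : cancel g f by move=> y; exact: svalP (cid (surjf y)).
have fK : cancel f g by move=> x; apply: injf; rewrite gK.
have W'g i y : W' i y <-> W i (g y) by rewrite -{1}[y]gK.
pose g' : {lrmorphism B' -> B} := HB.pack g
  (GRing.isLinear.Build k B' B *:%R g (can2_linear fK gK))
  (GRing.isMonoidMorphism.Build B' B g (can2_monoid_morphism fK gK)).
have gW' : is_grading W'.
  pose H := Grading gW; have [sW W1 WM _] := gW.
  (* The projections are those of [W] conjugated by [f]. *)
  apply: (is_grading_proj (p := fun i y => f (hproj H i (g' y)))).
  - move=> i; split=> [|c x y].
      by apply/W'g; rewrite -[g]/(g' : _ -> _) linear0; case: (sW i).
    move=> /W'g Wx /W'g Wy; apply/W'g; rewrite -[g]/(g' : _ -> _) linearP.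
    by case: (sW i) => _; apply.
  - by apply/W'g; rewrite -[g]/(g' : _ -> _) rmorph1.
  - move=> i j x y /W'g Wx /W'g Wy; apply/W'g.
    by rewrite -[g]/(g' : _ -> _) rmorphM; exact: WM.
  - by move=> i x y; rewrite !raddfD.
  - by move=> i x; apply/WW'; exact: (hproj_in H).
  - move=> i j x /W'g Wx; rewrite (hproj_homog j (W := H) Wx).
    by case: eqP => _; rewrite ?raddf0 // -[RHS]gK.
  - move=> y; have /fin_suppP[X Xy] := hproj_fin H (g y).
    rewrite -[y]gK (hproj_sum H (g y)) (fsbigTE X) // raddf_sum.
    apply: is_subspace_bigsum => [|j]; first exact: Defs.span_subspace.
    by apply: Defs.sub_span; exists j; apply/WW'; exact: (hproj_in H).
split; first by split=> // i x /WW'.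
by exists g'; split=> //; split=> // i x /W'g.
Qed.

End GradingsByProjections.

(** * Coefficients in the group algebra *)

Section GroupAlgebraCoefficients.
Variables (k : fieldType) (B : algType k) (Gam : zmodType).

Lemma gcoef_linear a : linear (fun F : galg B Gam => gcoef F a).
Proof. by []. Qed.

Lemma gcoef_sum a (I : Type) (r : seq I) (F : I -> galg B Gam) :
  gcoef (\sum_(i <- r) F i) a = \sum_(i <- r) gcoef (F i) a.
Proof. exact: (big_morph (fun F : galg B Gam => gcoef F a)). Qed.

Lemma galg_sum_gdelta (X : {fset Gam}) (F : galg B Gam) :
  (forall a, a \notin X -> gcoef F a = 0) ->
  F = \sum_(a <- X) gdelta (gcoef F a) a.
Proof.
move=> XF; apply: galgP => a; rewrite gcoef_sum /=.
have [aX|aX] := boolP (a \in X).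
  rewrite (bigD1_seq a) ?fset_uniq //= eqxx big1 ?addr0 // => b ba.
  by rewrite eq_sym (negbTE ba).
rewrite XF // big_seq big1 // => b bX.
by case: eqP aX => // ->; rewrite bX.
Qed.

End GroupAlgebraCoefficients.

(** * Interpretation of characters as functions *)

Section CharacterEvaluation.
Variables (k : fieldType) (G : zmodType) (A : algType k).
Local Notation hatG := (chargrp k G).

(* Dedekind: subtracting [c h] times the relation at [g] from the relation at
   [g + h] eliminates the character [c]. *)
Lemma chargrp_free (s : seq hatG) (a : hatG -> A) : uniq s ->
  (forall g, \sum_(chi <- s) chi g *: a chi = 0) ->
  forall chi, chi \in s -> a chi = 0.
Proof.
elim: s a => [|c s IHs] a //= /andP[cs s_uniq] sum0.
have as0 psi : psi \in s -> a psi = 0.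
  move=> psis; have [h hP] : exists h, psi h != c h.
    apply: contrapT => nex; move: cs; rewrite -(_ : psi = c) ?psis //.
    by apply: char_eq => h; apply: contrapT => /eqP hP; apply: nex; exists h.
  suff /eqP : (psi h - c h) *: a psi = 0.
    by rewrite scaler_eq0 subr_eq0 (negbTE hP) => /eqP.
  apply: (IHs (fun chi => (chi h - c h) *: a chi)) => // g.
  transitivity (\sum_(chi <- c :: s) chi g *: ((chi h - c h) *: a chi)).
    by rewrite big_cons subrr scale0r scaler0 add0r.
  transitivity (\sum_(chi <- c :: s)
      (chi (g + h) *: a chi - c h *: (chi g *: a chi))).
    apply: eq_bigr => chi _.
    by rewrite charD !scalerA -scalerBl mulrBr [_ * c h]mulrC.
  by rewrite sumrB -scaler_sumr !sum0 scaler0 subr0.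
move=> chi; rewrite in_cons => /predU1P[->|/as0//].
(* Once the other coefficients vanish, the relation at [0] leaves [c 0 *: a c], and [c 0] is a
   unit. *)
have /eqP := sum0 0; rewrite big_cons big_seq big1 ?addr0 => [|psi psis].
  by have := char_unit c 0; rewrite unitfE scaler_eq0 => /negbTE -> /eqP.
by rewrite as0 ?scaler0.
Qed.

Definition galg_eval (F : galg A hatG) : fun_alg G A :=
  fun g => \sum_(chi \in [set: hatG]) chi g *: gcoef F chi.

Lemma galg_evalE (X : {fset hatG}) F g :
  (forall chi, chi \notin X -> gcoef F chi = 0) ->
  galg_eval F g = \sum_(chi <- X) chi g *: gcoef F chi.
Proof. by move=> XF; apply: fsbigTE => chi /XF ->; rewrite scaler0. Qed.

Lemma galg_eval_gdelta x (chi : hatG) :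
  galg_eval (gdelta x chi) = (fun g => chi g *: x).
Proof.
apply/funext => g; rewrite (galg_evalE (X := [fset chi]%fset)).
  by rewrite big_seq_fset1 /= eqxx.
by move=> psi; rewrite inE => /negbTE /= ->.
Qed.

Lemma galg_eval_linear : linear galg_eval.
Proof.
move=> c F F'; apply/funext => g.
have /fin_suppP[X XF] := gcoef_fin F; have /fin_suppP[Y YF] := gcoef_fin F'.
have XY chi : chi \notin (X `|` Y)%fset -> gcoef F chi = 0 /\ gcoef F' chi = 0.
  by rewrite inE negb_or => /andP[/XF -> /YF ->].
rewrite -[RHS]/(c *: galg_eval F g + galg_eval F' g).
rewrite !(galg_evalE (X := (X `|` Y)%fset)); try by move=> chi /XY [].
  rewrite scaler_sumr -big_split; apply: eq_bigr => chi _.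
  by rewrite gcoef_linear scalerDr !scalerA mulrC.
by move=> chi /XY[F0 F'0]; rewrite gcoef_linear F0 F'0 scaler0 addr0.
Qed.

HB.instance Definition _ :=
  GRing.isLinear.Build k (galg A hatG) (fun_alg G A) *:%R galg_eval
    galg_eval_linear.

(** By bilinearity it is enough to multiply elementary tensors, and the group law of [hatG] is the
    pointwise product. *)
Lemma galg_eval_monoid_morphism : monoid_morphism galg_eval.
Proof.
split.
  rewrite -[X in galg_eval X]/(gdelta 1 0) galg_eval_gdelta; apply/funext => g.
  exact: scale1r.
move=> F F'; have /fin_suppP[X XF] := gcoef_fin F.
have /fin_suppP[Y YF] := gcoef_fin F'.
rewrite (galg_sum_gdelta XF) (galg_sum_gdelta YF).
rewrite mulr_suml !linear_sum mulr_suml; apply: eq_bigr => a _.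
rewrite mulr_sumr linear_sum mulr_sumr; apply: eq_bigr => b _.
rewrite gdeltaM -[LHS]/(galg_eval _) -[RHS]/(galg_eval _ * galg_eval _).
rewrite !galg_eval_gdelta; apply/funext => g.
rewrite -[RHS]/((_ *: _) * (_ *: _)).
by rewrite -scalerAl -scalerAr scalerA.
Qed.

HB.instance Definition _ :=
  GRing.isMonoidMorphism.Build (galg A hatG) (fun_alg G A) galg_eval
    galg_eval_monoid_morphism.

(** A difference evaluating to zero is a linear relation between distinct characters with
    coefficients in [A]. *)
Lemma galg_eval_inj : injective galg_eval.
Proof.
move=> F F' /eqP; rewrite -subr_eq0 -linearB => /eqP eval0; apply/eqP.
rewrite -subr_eq0; apply/eqP; set D := F - F' in eval0 *.
have /fin_suppP[X XD] := gcoef_fin D.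
apply: galgP => chi; have [chiX|/XD//] := boolP (chi \in X).
apply: (@chargrp_free X (gcoef D)) => // [|g]; first exact: fset_uniq.
by rewrite -galg_evalE // eval0.
Qed.

End CharacterEvaluation.

Lemma subalg_val_sum (k : fieldType) (B : algType k) (S : subalgebra B)
    (J : Type) (r : seq J) (F : J -> subalg_of S) :
  subalg_val (\sum_(j <- r) F j) = \sum_(j <- r) subalg_val (F j).
Proof. exact: (raddf_sum val). Qed.

(** * Homogeneous components and gradings of the phi-centre *)

Section Centres.
Variables (k : fieldType) (G : zmodType) (A : algType k) (W : grading G A).
Local Notation hatG := (chargrp k G).
Local Notation Zphi := (subalg_of (phi_centre W)).
Local Notation ZG := (subalg_of (G_centre W)).

Let W_subspace g : is_subspace (W g).
Proof. by have [] := gradingP W. Qed.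

Let W_mul g h x y : W g x -> W h y -> W (g + h) (x * y).
Proof. by have [_ _ + _] := gradingP W; exact. Qed.

Lemma char0 (chi : hatG) : chi 0 = 1.
Proof. by apply: (mulrI (char_unit chi 0)); rewrite -charD addr0 mulr1. Qed.

(** Multiplication by [y] shifts every degree by [h], and this shift is injective. *)
Lemma hproj_mulr g h x y : W h y -> hproj W (g + h) (x * y) = hproj W g x * y.
Proof.
move=> Wy; have /fin_suppP[X Xx] := hproj_fin W x.
rewrite (hproj_sum W x) (fsbigTE X) // mulr_suml !linear_sum mulr_suml /=.
apply: eq_bigr => i _; rewrite (hproj_homog _ (W_mul (hproj_in W i x) Wy)).
rewrite (hproj_homog _ (hproj_in W i x)) (inj_eq (addIr h)).
by case: eqP; rewrite ?mul0r.
Qed.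

Lemma hproj_mull g h x y : W h y -> hproj W (g + h) (y * x) = y * hproj W g x.
Proof.
move=> Wy; have /fin_suppP[X Xx] := hproj_fin W x.
rewrite (hproj_sum W x) (fsbigTE X) // mulr_sumr !linear_sum mulr_sumr /=.
apply: eq_bigr => i _; rewrite (hproj_homog _ (W_mul Wy (hproj_in W i x))).
rewrite (hproj_homog _ (hproj_in W i x)) addrC (inj_eq (addrI h)).
by case: eqP; rewrite ?mulr0.
Qed.

(** Both sides of the centrality condition are additive in [y], and on degree [h] the action of
    [chi] is the scalar [chi h]. *)
Lemma phi_centralP x (chi : hatG) :
  phi_central W x chi <-> forall h y, W h y -> x * y = chi h *: (y * x).
Proof.
split=> [xP h y Wy|xP y]; first by rewrite xP (phi_homog _ Wy) -scalerAl.
have /fin_suppP[X Xy] := hproj_fin W y.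
rewrite /phi (fsbigTE X) => [|g /Xy ->]; last by rewrite scaler0.
rewrite {1}(hproj_sum W y) (fsbigTE X) // mulr_sumr mulr_suml.
apply: eq_bigr => g _; rewrite (xP _ _ (hproj_in W g y)).
exact: scalerAl.
Qed.

Lemma phi_central_subspace (chi : hatG) :
  is_subspace [set x | phi_central W x chi].
Proof.
split=> [y|c u v uP vP y] /=; first by rewrite mul0r mulr0.
by rewrite mulrDl mulrDr -scalerAl -scalerAr uP vP.
Qed.

(** Compare the components of degree [g + h] of [x * y] and [chi h *: (y * x)]. *)
Lemma phi_central_hproj g x (chi : hatG) :
  phi_central W x chi -> phi_central W (hproj W g x) chi.
Proof.
move=> /phi_centralP xP; apply/phi_centralP => h y Wy.
by rewrite -(hproj_mulr _ _ Wy) -(hproj_mull _ _ Wy) (xP _ _ Wy) linearZ.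
Qed.

(** The elements central for a fixed [chi] form a subspace, so membership in the span can be tested
    on each coefficient. *)
Lemma phi_centreP F : phi_centre_set W F <->
  forall chi, phi_central W (gcoef F chi) chi.
Proof.
split=> [FZ|FP].
  move: F FZ; apply: (span_least (W := [set F : galg A hatG |
    forall chi, phi_central W (gcoef F chi) chi])) => [|F].
    split=> [chi|c u v uP vP chi]; first by case: (phi_central_subspace chi).
    rewrite gcoef_linear; case: (phi_central_subspace chi) => _; apply.
      exact: uP.
    exact: vP.
  move=> [x [chi [xP ->]]] psi /=; case: eqP => [->//|_].
  by case: (phi_central_subspace psi).
have /fin_suppP[X XF] := gcoef_fin F.
rewrite (galg_sum_gdelta XF); apply: is_subspace_bigsum => [|chi].
  exact: Defs.span_subspace.
by apply: Defs.sub_span; exists (gcoef F chi), chi.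
Qed.

Lemma gdelta_phi_central x (chi : hatG) :
  phi_central W x chi -> phi_centre_set W (gdelta x chi).
Proof. by move=> xP; apply: Defs.sub_span; exists x, chi. Qed.

Lemma gdelta_linear (chi : hatG) : linear (fun x : A => gdelta x chi).
Proof.
move=> c x y; apply: galgP => psi; rewrite gcoef_linear /=.
by case: eqP => // _; rewrite scaler0 addr0.
Qed.

Lemma gdeltaD (chi : hatG) :
  {morph (fun x : A => gdelta x chi : galg A hatG) : x y / x + y}.
Proof. by move=> x y; have := gdelta_linear chi 1 x y; rewrite !scale1r. Qed.

Lemma gdelta0 (chi : hatG) : gdelta (0 : A) chi = 0 :> galg A hatG.
Proof. by apply: (addrI (gdelta 0 chi)); rewrite -gdeltaD !addr0. Qed.

Lemma gcoef_phi_central (z : Zphi) chi :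
  phi_central W (gcoef (subalg_val z) chi) chi.
Proof. exact: (proj1 (phi_centreP _) (subalg_valP z)). Qed.

Definition phi_centre_bihproj (i : G * hatG) (z : Zphi) : Zphi :=
  subalg_in (S := phi_centre W) (gdelta_phi_central
    (phi_central_hproj i.1 (gcoef_phi_central z i.2))).

Lemma phi_centre_bihproj_sum (z : Zphi) : exists (X : {fset hatG}) Y,
  z = \sum_(chi <- X) \sum_(g <- Y chi : {fset G})
        phi_centre_bihproj (g, chi) z.
Proof.
have /fin_suppP[X Xz] := gcoef_fin (subalg_val z).
have /choice[Y Yz] chi : exists Y : {fset G}, forall g, g \notin Y ->
    hproj W g (gcoef (subalg_val z) chi) = 0.
  exact/fin_suppP/hproj_fin.
exists X, Y; apply: val_inj; rewrite /= subalg_val_sum {1}(galg_sum_gdelta Xz).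
apply: eq_bigr => chi _; rewrite subalg_val_sum /=.
rewrite {1}(hproj_sum W (gcoef _ chi)) (fsbigTE (Y chi)) => [|g]; last first.
  exact: Yz.
exact: (big_morph (fun x => gdelta x chi) (gdeltaD chi) (gdelta0 chi)).
Qed.

Lemma phi_centre_bihprojP i z :
  phi_centre_bicomp i (phi_centre_bihproj i z).
Proof.
by exists (hproj W i.1 (gcoef (subalg_val z) i.2)); first exact: hproj_in.
Qed.

Lemma phi_centre_bicomp_span (z : Zphi) :
  Defs.span [set z | exists i, phi_centre_bicomp (W := W) i z] z.
Proof.
have [X [Y ->]] := phi_centre_bihproj_sum z.
do 2!(apply: is_subspace_bigsum => [|?]; first exact: Defs.span_subspace).
apply: Defs.sub_span; eexists; exact: phi_centre_bihprojP.
Qed.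

Lemma phi_centre_bigrading : is_grading (phi_centre_bicomp (W := W)).
Proof.
apply: (is_grading_proj (p := phi_centre_bihproj)).
- move=> [g chi]; split.
    exists 0; first by case: (W_subspace g).
    by rewrite gdelta0.
  move=> c u v [x Wx ux] [y Wy vy]; exists (c *: x + y).
    by case: (W_subspace g) => _; apply.
  by rewrite gdelta_linear -ux -vy; exact: (linearP val).
- exists 1; first by have [] := gradingP W.
  by [].
- move=> [g chi] [h psi] u v [x Wx ux] [y Wy vy]; exists (x * y).
    exact: W_mul.
  by rewrite -gdeltaM -ux -vy; exact: (rmorphM val).
- move=> [g chi] u v; apply: val_inj.
  by rewrite [RHS](raddfD val) /= -gdeltaD -linearD.
- exact: phi_centre_bihprojP.
- move=> [g chi] [h psi] z [x Wx zx]; apply: val_inj => /=.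
  rewrite zx /= xpair_eqE andbC; apply: galgP => rho /=.
  case: (eqVneq psi chi) => [->|psichi] /=.
    rewrite (hproj_homog h Wx); case: (eqVneq h g) => _; first by rewrite zx.
    by case: eqP.
  by rewrite linear0; case: eqP.
- exact: phi_centre_bicomp_span.
Qed.

(** For the converse, [z] is the sum of its terms [F chi], each of which is itself central. *)
Lemma phi_centre_compP g (z : Zphi) : phi_centre_comp g z <->
  forall chi, W g (gcoef (subalg_val z) chi).
Proof.
split=> [|zP].
  move: z; apply: (span_least (W := [set z : Zphi |
    forall chi, W g (gcoef (subalg_val z) chi)])).
    split=> [chi|c u v uP vP chi] /=; first by case: (W_subspace g).
    rewrite -[X in W g X]/(c *: gcoef (subalg_val u) chi +
                           gcoef (subalg_val v) chi).
    by case: (W_subspace g) => _; apply; [exact: uP|exact: vP].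
  move=> z [psi [x Wx zx]] chi; rewrite zx /=.
  by case: eqP => // _; case: (W_subspace g).
have /fin_suppP[X Xz] := gcoef_fin (subalg_val z).
pose F chi : Zphi :=
  subalg_in (S := phi_centre W) (gdelta_phi_central (gcoef_phi_central z chi)).
have -> : z = \sum_(chi <- X) F chi.
  by apply: val_inj; rewrite /= subalg_val_sum {1}(galg_sum_gdelta Xz).
apply: is_subspace_bigsum => [|chi]; first exact: Defs.span_subspace.
by apply: Defs.sub_span; exists chi, (gcoef (subalg_val z) chi).
Qed.

Lemma galg_hproj_fin g (F : galg A hatG) :
  fin_supp (fun chi : hatG => hproj W g (gcoef F chi)).
Proof.
apply: (@fin_supp_comp hatG A A (gcoef F) (fun=> hproj W g)).
  by move=> _; exact: linear0.
exact: gcoef_fin.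
Qed.

Lemma galg_hproj_central g (z : Zphi) :
  phi_centre_set W (galg_of (galg_hproj_fin g (subalg_val z))).
Proof.
by apply/phi_centreP => chi; apply/phi_central_hproj/gcoef_phi_central.
Qed.

Lemma phi_centre_grading : is_grading (phi_centre_comp (W := W)).
Proof.
apply: (is_grading_proj
  (p := fun g z => subalg_in (S := phi_centre W) (galg_hproj_central g z))).
- by move=> g; exact: Defs.span_subspace.
- apply/phi_centre_compP => chi /=; case: eqP => _.
    by have [] := gradingP W.
  by case: (W_subspace 0).
- move=> g h u v /phi_centre_compP uP /phi_centre_compP vP.
  apply/phi_centre_compP => chi.
  have /fin_suppP[X Xu] := gcoef_fin (subalg_val u).
  rewrite -[gcoef _ _]/(gconv (gcoef (subalg_val u))
                              (gcoef (subalg_val v)) chi).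
  rewrite (gconvE _ _ Xu); apply: is_subspace_bigsum => // psi.
  exact: W_mul.
- move=> g u v; apply: val_inj; apply: galgP => chi /=.
  by rewrite -[RHS]/(hproj W g _ + hproj W g _) -linearD.
- move=> g z; apply/phi_centre_compP => chi; exact: hproj_in.
- move=> g h z /phi_centre_compP zP; apply: val_inj; apply: galgP => chi /=.
  by rewrite (hproj_homog h (zP chi)); case: eqP.
- move=> z.
  (* Bihomogeneous elements already span, and each of them is homogeneous for the coarser
     grading. *)
  apply: (span_least (Defs.span_subspace _)) (phi_centre_bicomp_span z).
  move=> u [[g chi] ui]; apply: Defs.sub_span; exists g.
  by apply: Defs.sub_span; exists chi.
Qed.

(** * The map from the phi-centre to the [G]-centre *)

Lemma galg_eval_centre F :
  phi_centre_set W F -> G_centre_set W (galg_eval F).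
Proof.
have [sZ _ _] := G_centre_subalg W.
apply: (span_least (W := [set F | G_centre_set W (galg_eval F)])).
  split=> [|c u v Zu Zv] /=; first by rewrite linear0; case: sZ.
  by rewrite linearP; case: sZ => _; apply.
move=> _ [x [chi [/phi_centralP xP ->]]] /=; rewrite galg_eval_gdelta.
(* Commuting [x] past [y] produces [chi h], which turns the scalar [chi g] into [chi (g + h)], the
   shift in the [G]-centre. *)
move=> g h y Wy; rewrite -scalerAl (xP _ _ Wy) -scalerAr charD.
by rewrite scalerA.
Qed.

Definition centre_map (z : Zphi) : ZG :=
  subalg_in (S := G_centre W) (galg_eval_centre (subalg_valP z)).

Lemma centre_map_linear : linear centre_map.
Proof. by move=> c u v; apply: val_inj; rewrite linearP /= -linearP. Qed.

Lemma centre_map_monoid_morphism : monoid_morphism centre_map.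
Proof.
split=> [|u v]; apply: val_inj; first by rewrite /= rmorph1.
by rewrite rmorphM /= -rmorphM.
Qed.

HB.instance Definition _ :=
  GRing.isLinear.Build k Zphi ZG *:%R centre_map centre_map_linear.
HB.instance Definition _ :=
  GRing.isMonoidMorphism.Build Zphi ZG centre_map centre_map_monoid_morphism.

Lemma centre_map_inj : injective centre_map.
Proof.
by move=> u v /(congr1 val) /= /galg_eval_inj uv; exact: val_inj.
Qed.

Lemma centre_map_comp g z :
  phi_centre_comp g z -> G_centre_comp g (centre_map z).
Proof.
move=> /phi_centre_compP zP h /=.
have /fin_suppP[X Xz] := gcoef_fin (subalg_val z).
rewrite (galg_evalE _ Xz); apply: is_subspace_bigsum => // chi.
exact: is_subspaceZ.
Qed.

Lemma centre_map_act l z :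
  centre_map (phi_centre_act l z) = G_centre_act l (centre_map z).
Proof.
apply: val_inj; apply/funext => g /=; rewrite /galg_eval.
by apply: eq_fsbigr => chi _ /=; rewrite scalerA charD mulrC.
Qed.

(** In the forward direction, the image of [z] is [g |-> chi g *: x] with [x] its value at [0]; this
    is also the evaluation of [gdelta x chi], and evaluation is injective. *)
Lemma centre_map_bicomp i z :
  G_centre_bicomp i (centre_map z) <-> phi_centre_bicomp i z.
Proof.
case: i => g chi; split=> [[zg zchi]|[x Wx zx]].
  exists (subalg_val (centre_map z) 0); first exact: zg.
  apply: galg_eval_inj; rewrite galg_eval_gdelta; apply/funext => h.
  exact: zchi.
have zE h : subalg_val (centre_map z) h = chi h *: x.
  by rewrite /= zx galg_eval_gdelta.
split=> h; first by rewrite zE; exact: is_subspaceZ.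
by rewrite !zE char0 scale1r.
Qed.

(** At [g = 0] the relation of the [G]-centre says that the value of [u] at [0] is phi-central for
    [chi]; with [chi] it gives the preimage. *)
Lemma centre_map_char_comp chi (u : ZG) :
  G_centre_char_comp chi u -> exists z, centre_map z = u.
Proof.
move=> uchi; have uP : phi_central W (subalg_val u 0) chi.
  apply/phi_centralP => h y Wy.
  by rewrite (subalg_valP u _ _ _ Wy) add0r uchi scalerAr.
exists (subalg_in (S := phi_centre W) (gdelta_phi_central uP)).
apply: val_inj; rewrite /= galg_eval_gdelta; apply/funext => g.
by rewrite -uchi.
Qed.

(** * Translations on the [G]-centre and their joint eigenvectors *)

Lemma G_centre_act_linear l : linear (G_centre_act (W := W) l).
Proof. by move=> c u v; apply: val_inj. Qed.

HB.instance Definition _ l :=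
  GRing.isLinear.Build k ZG ZG *:%R (G_centre_act (W := W) l)
    (G_centre_act_linear l).

Lemma iter_G_centre_act m l (u : ZG) g :
  subalg_val (iter m (G_centre_act l) u) g = subalg_val u (l *+ m + g).
Proof.
elim: m g => [|m IHm] g; first by rewrite mulr0n add0r.
by rewrite iterS /= IHm addrA -mulrSr.
Qed.

(** Translating from [0] shows that [u] takes the value [c l *: x] at [l]. If [x] is nonzero,
    comparing multiples of [x] makes the eigenvalue function [c] a character. *)
Lemma G_centre_joint_eigen (u : ZG) :
  (forall l, exists c : k, G_centre_act l u = c *: u) ->
  u = 0 \/ exists chi, G_centre_char_comp chi u.
Proof.
move=> /choice[c cP]; pose x := subalg_val u 0.
have uD l g : subalg_val u (l + g) = c l *: subalg_val u g.
  by have /(congr1 (fun v : ZG => subalg_val v g)) := cP l.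
have uE l : subalg_val u l = c l *: x by rewrite -[l in LHS]addr0 uD.
have [x0|x0] := eqVneq x 0.
  left; apply: val_inj; apply/funext => l /=.
  by rewrite uE x0 scaler0.
have x_inj a b : a *: x = b *: x -> a = b.
  move=> /eqP; rewrite -subr_eq0 -scalerBl scaler_eq0 (negbTE x0) orbF.
  by rewrite subr_eq0 => /eqP.
have c0 : c 0 = 1 by apply: x_inj; rewrite -uE scale1r.
have cD l m : c (l + m) = c l * c m.
  by apply: x_inj; rewrite -uE uD uE scalerA.
have cU l : c l \is a GRing.unit.
  rewrite unitfE; apply/eqP => cl0; have := cD l (- l).
  by rewrite subrr c0 cl0 mul0r => /eqP; rewrite oner_eq0.
by right; exists (char_of (conj cU cD)).
Qed.

End Centres.

(** * The [G]-grading of the [G]-centre *)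

Section GCentreGrading.
Variables (k : fieldType) (G : zmodType) (A : falgType k) (W : grading G A).
Local Notation ZG := (subalg_of (G_centre W)).

(** A projection that kills a basis is zero, so [Y] can be the union of the finite supports of the
    basis vectors. *)
Lemma grading_finite :
  exists Y : {fset G}, forall g, g \notin Y -> forall x, hproj W g x = 0.
Proof.
have [Y Ys] : exists Y : {fset G}, forall g, g \notin Y ->
    forall x, x \in (vbasis {: A} : seq A) -> hproj W g x = 0.
  elim: (vbasis _ : seq A) => [|a s [Y Ys]]; first by exists fset0.
  have /fin_suppP[X Xa] := hproj_fin W a; exists (X `|` Y)%fset => g.
  rewrite inE negb_or => /andP[gX gY] x; rewrite in_cons => /predU1P[->|].
    exact: Xa.
  exact: Ys.
exists Y => g gY x; rewrite (coord_vbasis (memvf x)) linear_sum big1 // => i _.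
by rewrite linearZ /= Ys ?scaler0 // mem_nth // size_tuple.
Qed.

Lemma G_centre_hproj g (z : ZG) :
  G_centre_set W (fun h => hproj W g (subalg_val z h)).
Proof.
move=> l h y Wy; rewrite -(hproj_mulr _ _ Wy) -(hproj_mull _ _ Wy).
by rewrite (subalg_valP z _ _ _ Wy).
Qed.

Lemma G_centre_grading : is_grading (G_centre_comp (W := W)).
Proof.
have [sW W1 WM _] := gradingP W.
apply: (is_grading_proj
  (p := fun g z => subalg_in (S := G_centre W) (G_centre_hproj g z))).
- move=> g; split=> [h|c u v uP vP h]; first by case: (sW g).
  by case: (sW g) => _; apply; [exact: uP|exact: vP].
- by move=> h.
- by move=> g h u v uP vP l; apply: WM; [exact: uP|exact: vP].
- by move=> g u v; apply: val_inj; apply/funext => h; exact: linearD.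
- by move=> g z h; exact: hproj_in.
- move=> g h z zP; apply: val_inj; apply/funext => l /=.
  by rewrite (hproj_homog h (zP l)); case: eqP.
(* A function on [G] may take infinitely many values; the uniform bound [Y] decomposes all of them
   with the same finite set of degrees. *)
- move=> z; have [Y YW] := grading_finite.
  have -> : z = \sum_(g <- Y) subalg_in (S := G_centre W) (G_centre_hproj g z).
    apply: val_inj; rewrite /= subalg_val_sum; apply/funext => h.
    rewrite fct_sumE {1}(hproj_sum W (subalg_val z h)) (fsbigTE Y) // => g gY.
    exact: YW.
  apply: is_subspace_bigsum => [|g]; first exact: Defs.span_subspace.
  by apply: Defs.sub_span; exists g => h; exact: hproj_in.
Qed.

End GCentreGrading.

(** The image is a subspace and contains every joint eigenvector of the translations, which commute
    and have [n]-th iterate the identity; such eigenvectors span the [G]-centre. *)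
Lemma centre_map_surj (k : closedFieldType) (G : zmodType) (A : algType k)
    (W : grading G A) (n : nat) :
  ([set: G] #= `I_n)%card -> n%:R != 0 :> k ->
  forall u, exists z, centre_map (W := W) z = u.
Proof.
move=> Gn n0; have Gfin : finite_set [set: G] by exists n.
have GX g : g \in fset_set [set: G] by rewrite in_fset_set // inE.
have gn (g : G) : g *+ n = 0.
  by rewrite -(card_fset_set Gn); exact: fset_zmod_mulrn.
have actn l (u : subalg_of (G_centre W)) : iter n (G_centre_act l) u = u.
  by apply: val_inj; apply/funext => g; rewrite /= iter_G_centre_act gn add0r.
have actC l m (u : subalg_of (G_centre W)) :
    G_centre_act l (G_centre_act m u) = G_centre_act m (G_centre_act l u).
  by apply: val_inj; apply/funext => g; rewrite /= addrCA.
move=> u.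
have := @span_joint_eigen _ _ G
  (fun l => (G_centre_act l : {linear _ -> _})) n n0 actn actC
  (fset_set [set: G]) u.
apply: (span_least (W := [set u | exists z, centre_map z = u])).
  split=> [|c _ _ [y <-] [z <-]]; first by exists 0; exact: linear0.
  by exists (c *: y + z); exact: linearP.
move=> v vE; have [l|->|[chi vchi]] := @G_centre_joint_eigen _ _ _ _ v.
- exact: vE.
- by exists 0; exact: linear0.
- exact: centre_map_char_comp vchi.
Qed.

Theorem proposition33 (k : closedFieldType) (G : zmodType) (A : falgType k)
    (W : grading G A) :
  exists ev : {lrmorphism galg A (chargrp k G) -> fun_alg G A},
    [/\ forall (x : A) (chi : chargrp k G),
          ev (gdelta x chi) = (fun g => chi g *: x),
        injective ev
      & exists iota :
          {lrmorphism subalg_of (phi_centre W) -> subalg_of (G_centre W)},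
          [/\ forall z, subalg_val (iota z) = ev (subalg_val z),
              injective iota,
              is_graded_morphism (phi_centre_comp (W := W))
                (G_centre_comp (W := W)) iota,
              forall (l : G) z,
                iota (phi_centre_act l z) = G_centre_act l (iota z)
            & forall n : nat, ([set: G] #= `I_n)%card ->
                (forall p, p \in [pchar k] -> ~~ (p %| n)%N) ->
                is_graded_isomorphism (phi_centre_bicomp (W := W))
                  (G_centre_bicomp (W := W)) iota]].
Proof.
exists (galg_eval (A := A)); split.
- by move=> x chi; exact: galg_eval_gdelta.
- exact: galg_eval_inj.
exists (centre_map (W := W)); split=> //.
- exact: centre_map_inj.
- split; [exact: phi_centre_grading|exact: G_centre_grading|].
  exact: centre_map_comp.
- exact: centre_map_act.
move=> n Gn n_pchar.
apply: bij_graded_isomorphism.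
- exact: phi_centre_bigrading.
- exact: centre_map_bicomp.
- exact: centre_map_inj.
(* [G] contains [0], so [n] is positive; if it vanished in [k], the characteristic would be a prime
   dividing [n]. *)
apply: (centre_map_surj Gn); apply/negP => n0.
have n_gt0 : (0 < n)%N.
  rewrite lt0n; apply/eqP => n_eq0; move: Gn; rewrite n_eq0 II0 card_eq0.
  by move=> /eqP G0; have : [set: G] 0 by []; rewrite G0.
have [p pk] := natf0_pchar n_gt0 n0.
by have := n_pchar p pk; rewrite (dvdn_pcharf pk) n0.
Qed.
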